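(* Let $T,T_{\mathrm{off}}$ be positive integers and consider $$\min_{\substack{l_M\in\mathbb{N},\ \alpha_l\in[0,1]\\1\le l\le l_M}}\ \sum_{l=1}^{l_M}2^l\frac{1-\alpha_l}{\alpha_l}\quad\text{s.t.}\quad\sum_{l=1}^{l_M}(1-\alpha_l)2^{2l}\ge T,\qquad\sum_{l=1}^{l_M}\alpha_l2^{2l}\le T_{\mathrm{off}}.$$ Its optimal value is $\Omega\big(\frac{T}{\sqrt{T+T_{\mathrm{off}}}}\big)$. In the regime $T_{\mathrm{off}}>T$, the choice $\alpha_l=\frac{T_{\mathrm{off}}}{T+T_{\mathrm{off}}}$ for all $l$ and $l_M=\Theta(\log_2\sqrt{T+T_{\mathrm{off}}})$ is feasible and has objective value $O\big(\frac{T}{\sqrt{T+T_{\mathrm{off}}}}\big)$. Moreover, the choice $\alpha_l=\frac{T_{\mathrm{off}}}{T+T_{\mathrm{off}}}$, $l_M=\Theta(\log_2\sqrt{T+T_{\mathrm{off}}})$ is optimal among schedules in which $\alpha_l$ is the same for every $l\le l_M$.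
   Context: The constants implicit in $\Omega$, $O$ and $\Theta$ are absolute.
   Formalization: For the choice $\alpha_l=\frac{T_{\mathrm{off}}}{T+T_{\mathrm{off}}}$, the offline constraint is relaxed to an absolute constant multiple of $T_{\mathrm{off}}$, and its objective is only at most an absolute constant times that of every feasible constant schedule, not exactly optimal. The statement above fails without it. *)

(* Defs.v *)
From Stdlib Require Import Reals Lra Lia.
Open Scope R_scope.

Fixpoint sumR (f : nat -> R) (n : nat) : R :=
  match n with
  | O => 0
  | S k => sumR f k + f (S k)
  end.

Definition objective (lM : nat) (a : nat -> R) : R :=
  sumR (fun l => 2 ^ l * ((1 - a l) / a l)) lM.

Definition online_work (lM : nat) (a : nat -> R) : R :=
  sumR (fun l => (1 - a l) * 2 ^ (2 * l)) lM.

Definition offline_work (lM : nat) (a : nat -> R) : R :=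
  sumR (fun l => a l * 2 ^ (2 * l)) lM.

(* Feasibility of (lM, a) for budgets T, Toff.  a_l must lie in (0,1]:
   a_l = 0 makes the objective term (1-a_l)/a_l infinite. *)
Definition feasible (T Toff : nat) (lM : nat) (a : nat -> R) : Prop :=
  (forall l, (1 <= l <= lM)%nat -> 0 < a l <= 1) /\
  INR T <= online_work lM a /\
  offline_work lM a <= INR Toff.

Definition log2sqrt (x : R) : R := ln (sqrt x) / ln 2.

Definition alpha_choice (T Toff : nat) : nat -> R :=
  fun _ => INR Toff / (INR T + INR Toff).

(* Main.v *)
Require Import Defs.
From Stdlib Require Import Reals Lra Lia Psatz.
Open Scope R_scope.

(* One offline term already gives a_l 4^l <= Toff, hence a_l 2^l <= sqrt Toff, so each
   online term (1 - a_l) 4^l is at most sqrt Toff times the objective term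
   2^l (1 - a_l) / a_l; summing, T <= sqrt Toff * objective.
   For a constant schedule the three sums are geometric.  Taking the least level n with
   (4^(n+1) - 4) / 3 >= T + Toff, the choice a = Toff / (T + Toff) meets the online budget,
   exceeds the offline one by at most a factor 6, and has 2^n = Theta(sqrt (T + Toff)), so
   its objective is (T / Toff) O(sqrt T + sqrt Toff).  A feasible constant schedule b has
   (1 - b) / b >= T / Toff and 2^(m+1) - 2 >= sqrt T, and the general bound handles the
   sqrt Toff part. *)

Lemma sumR_le (f g : nat -> R) n :
  (forall l, (1 <= l <= n)%nat -> f l <= g l) -> sumR f n <= sumR g n.
Proof.
  induction n as [|n IH]; intros Hfg; simpl; [lra|].
  assert (sumR f n <= sumR g n) by (apply IH; intros; apply Hfg; lia).
  assert (f (S n) <= g (S n)) by (apply Hfg; lia).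
  lra.
Qed.

Lemma sumR_nonneg (f : nat -> R) n :
  (forall l, (1 <= l <= n)%nat -> 0 <= f l) -> 0 <= sumR f n.
Proof.
  intros Hf. apply Rle_trans with (sumR (fun _ => 0) n); [|now apply sumR_le].
  clear Hf. induction n; simpl; lra.
Qed.

Lemma sumR_term_le (f : nat -> R) n l :
  (forall k, (1 <= k <= n)%nat -> 0 <= f k) -> (1 <= l <= n)%nat -> f l <= sumR f n.
Proof.
  induction n as [|n IH]; intros Hf Hl; simpl; [lia|].
  destruct (Nat.eq_dec l (S n)) as [->|Hne].
  - assert (0 <= sumR f n) by (apply sumR_nonneg; intros; apply Hf; lia). lra.
  - assert (f l <= sumR f n) by (apply IH; [intros; apply Hf|]; lia).
    assert (0 <= f (S n)) by (apply Hf; lia). lra.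
Qed.

Lemma sumR_mult_l (f : nat -> R) c n : sumR (fun l => c * f l) n = c * sumR f n.
Proof. induction n as [|n IH]; simpl; [|rewrite IH]; ring. Qed.

Lemma sumR_mult_r (f : nat -> R) c n : sumR (fun l => f l * c) n = sumR f n * c.
Proof. induction n as [|n IH]; simpl; [|rewrite IH]; ring. Qed.

Lemma sumR_add (f g : nat -> R) n : sumR (fun l => f l + g l) n = sumR f n + sumR g n.
Proof. induction n as [|n IH]; simpl; [|rewrite IH]; ring. Qed.

Lemma pow2_double l : 2 ^ (2 * l) = (2 ^ l) ^ 2.
Proof. rewrite <- pow_mult. f_equal. lia. Qed.

Definition pow4_sum (n : nat) : R := sumR (fun l => 2 ^ (2 * l)) n.

Definition pow2_sum (n : nat) : R := sumR (fun l => 2 ^ l) n.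

Lemma pow4_sum_closed n : 3 * pow4_sum n + 4 = (2 ^ S n) ^ 2.
Proof.
  induction n as [|n IH]; unfold pow4_sum in *; cbn [sumR]; [simpl; lra|].
  rewrite pow2_double, <- (tech_pow_Rmult 2 (S n)). nra.
Qed.

Lemma pow2_sum_closed n : pow2_sum n + 2 = 2 ^ S n.
Proof.
  induction n as [|n IH]; unfold pow2_sum in *; cbn [sumR]; [simpl; lra|].
  rewrite <- (tech_pow_Rmult 2 (S n)). lra.
Qed.

Lemma pow2_sum_nonneg n : 0 <= pow2_sum n.
Proof. apply sumR_nonneg. intros l _. apply pow_le. lra. Qed.

Lemma pow4_sum_le_sqr_pow2_sum n : pow4_sum n <= pow2_sum n ^ 2.
Proof.
  induction n as [|n IH]; [unfold pow4_sum, pow2_sum; simpl; lra|].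
  assert (Hsum := pow2_sum_nonneg n).
  assert (Hterm : 0 <= 2 ^ S n) by (apply pow_le; lra).
  unfold pow4_sum, pow2_sum in *; cbn [sumR]. rewrite pow2_double. nra.
Qed.

Lemma pow4_sum_ge_INR n : INR n <= pow4_sum n.
Proof.
  induction n as [|n IH]; unfold pow4_sum in *; cbn [sumR]; [simpl; lra|].
  rewrite S_INR. assert (1 <= 2 ^ (2 * S n)) by (apply pow_R1_Rle; lra). lra.
Qed.

Lemma online_add_offline n a : online_work n a + offline_work n a = pow4_sum n.
Proof.
  unfold online_work, offline_work, pow4_sum. rewrite <- sumR_add.
  induction n as [|n IH]; cbn [sumR]; [|rewrite IH]; ring.
Qed.

Lemma online_work_const n b : online_work n (fun _ => b) = (1 - b) * pow4_sum n.
Proof. exact (sumR_mult_l _ _ _). Qed.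

Lemma offline_work_const n b : offline_work n (fun _ => b) = b * pow4_sum n.
Proof. exact (sumR_mult_l _ _ _). Qed.

Lemma objective_const n b : objective n (fun _ => b) = (1 - b) / b * pow2_sum n.
Proof. rewrite Rmult_comm. exact (sumR_mult_r _ _ _). Qed.

Lemma online_term_le_objective_term (a p s : R) :
  0 < a <= 1 -> 0 < p -> 0 < s -> a * p ^ 2 <= s ^ 2 ->
  (1 - a) * p ^ 2 * / s <= p * ((1 - a) / a).
Proof.
  intros Ha Hp Hs Hoff.
  assert (Hap : a * p <= s) by nra.
  replace ((1 - a) * p ^ 2 * / s) with ((1 - a) * p * (p / s)) by (field; lra).
  replace (p * ((1 - a) / a)) with ((1 - a) * p * / a) by (field; lra).
  apply Rmult_le_compat_l; [nra|].
  apply Rmult_le_reg_l with (a * s); [nra|].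
  replace (a * s * (p / s)) with (a * p) by (field; lra).
  replace (a * s * / a) with s by (field; lra).
  exact Hap.
Qed.

Lemma feasible_objective_ge T Toff lM a :
  (0 < Toff)%nat -> feasible T Toff lM a -> INR T / sqrt (INR Toff) <= objective lM a.
Proof.
  intros HToff Hf. destruct Hf as (Ha & Hon & Hoff).
  assert (Hto : 0 < INR Toff) by (apply lt_0_INR; exact HToff).
  set (s := sqrt (INR Toff)).
  assert (Hs : 0 < s) by (apply sqrt_lt_R0; exact Hto).
  assert (Hss : s ^ 2 = INR Toff) by (unfold s; rewrite <- Rsqr_pow2; apply Rsqr_sqrt; lra).
  apply Rle_trans with (online_work lM a * / s).
  { apply Rmult_le_compat_r; [left; apply Rinv_0_lt_compat|]; lra. }
  unfold online_work, objective. rewrite <- sumR_mult_r.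
  apply sumR_le. intros l Hl. rewrite pow2_double.
  apply online_term_le_objective_term; [apply Ha, Hl | apply pow_lt; lra | exact Hs |].
  rewrite Hss, <- pow2_double. apply Rle_trans with (offline_work lM a); [|exact Hoff].
  apply (sumR_term_le (fun l => a l * 2 ^ (2 * l))); [|exact Hl].
  intros k Hk. destruct (Ha k Hk). apply Rmult_le_pos; [lra | apply pow_le; lra].
Qed.

Lemma feasible_objective_ge_total T Toff lM a :
  (0 < Toff)%nat -> feasible T Toff lM a ->
  INR T / sqrt (INR T + INR Toff) <= objective lM a.
Proof.
  intros HToff Hf.
  assert (Ht := pos_INR T).
  assert (Hto : 0 < INR Toff) by (apply lt_0_INR; exact HToff).
  eapply Rle_trans; [|exact (feasible_objective_ge _ _ _ _ HToff Hf)].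
  apply Rmult_le_compat_l; [exact Ht|].
  apply Rinv_le_contravar; [apply sqrt_lt_R0; exact Hto|]. apply sqrt_le_1_alt. lra.
Qed.

Lemma offline_work_nonneg T Toff n a : feasible T Toff n a -> 0 <= offline_work n a.
Proof.
  intros [Ha _]. apply sumR_nonneg. intros l Hl.
  destruct (Ha l Hl). apply Rmult_le_pos; [lra | apply pow_le; lra].
Qed.

Lemma feasible_sqrt_le_pow2_sum T Toff n a :
  feasible T Toff n a -> sqrt (INR T) <= pow2_sum n.
Proof.
  intros Hf.
  assert (Hoff := offline_work_nonneg _ _ _ _ Hf).
  assert (Hsum := online_add_offline n a).
  destruct Hf as (_ & Hon & _).
  rewrite <- (sqrt_pow2 (pow2_sum n)) by apply pow2_sum_nonneg.
  apply sqrt_le_1_alt.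
  assert (H := pow4_sum_le_sqr_pow2_sum n). lra.
Qed.

Lemma feasible_const_ratio T Toff m b : (0 < T)%nat -> (0 < Toff)%nat ->
  feasible T Toff m (fun _ => b) -> INR T / INR Toff <= (1 - b) / b.
Proof.
  intros HT HToff Hf. destruct Hf as (Hb & Hon & Hoff).
  assert (Ht : 0 < INR T) by (apply lt_0_INR; exact HT).
  assert (Hto : 0 < INR Toff) by (apply lt_0_INR; exact HToff).
  rewrite online_work_const in Hon. rewrite offline_work_const in Hoff.
  destruct m as [|m].
  { unfold pow4_sum in Hon; simpl in Hon; lra. }
  destruct (Hb 1%nat ltac:(lia)) as [Hb0 Hb1].
  apply Rmult_le_reg_r with (INR Toff * b); [nra|].
  replace (INR T / INR Toff * (INR Toff * b)) with (INR T * b) by (field; lra).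
  replace ((1 - b) / b * (INR Toff * b)) with ((1 - b) * INR Toff) by (field; lra).
  nra.
Qed.

Lemma sqrt_add_le x y : 0 <= x -> 0 <= y -> sqrt (x + y) <= sqrt x + sqrt y.
Proof.
  intros Hx Hy.
  assert (Hsx := sqrt_pos x). assert (Hsy := sqrt_pos y).
  rewrite <- (sqrt_pow2 (sqrt x + sqrt y)) by lra.
  apply sqrt_le_1_alt.
  assert (sqrt x * sqrt x = x) by (apply sqrt_sqrt; exact Hx).
  assert (sqrt y * sqrt y = y) by (apply sqrt_sqrt; exact Hy).
  nra.
Qed.

Lemma feasible_const_objective_ge T Toff m b : (0 < T)%nat -> (0 < Toff)%nat ->
  feasible T Toff m (fun _ => b) ->
  INR T / INR Toff * (sqrt (INR T) + sqrt (INR Toff)) <= 2 * objective m (fun _ => b).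
Proof.
  intros HT HToff Hf.
  assert (Hlow := feasible_objective_ge _ _ _ _ HToff Hf).
  assert (Hratio := feasible_const_ratio _ _ _ _ HT HToff Hf).
  assert (Hsqrt := feasible_sqrt_le_pow2_sum _ _ _ _ Hf).
  rewrite objective_const in *.
  assert (Ht : 0 < INR T) by (apply lt_0_INR; exact HT).
  assert (Hto : 0 < INR Toff) by (apply lt_0_INR; exact HToff).
  assert (Hs : 0 < sqrt (INR Toff)) by (apply sqrt_lt_R0; exact Hto).
  assert (Hss : sqrt (INR Toff) * sqrt (INR Toff) = INR Toff) by (apply sqrt_sqrt; lra).
  assert (Hq : 0 <= INR T / INR Toff) by (left; apply Rdiv_lt_0_compat; lra).
  assert (INR T / INR Toff * sqrt (INR Toff) = INR T / sqrt (INR Toff))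
    by (rewrite <- Hss at 1; field; lra).
  assert (INR T / INR Toff * sqrt (INR T) <= (1 - b) / b * pow2_sum m).
  { apply Rle_trans with (INR T / INR Toff * pow2_sum m); [apply Rmult_le_compat_l; lra|].
    apply Rmult_le_compat_r; [apply pow2_sum_nonneg | exact Hratio]. }
  lra.
Qed.

Lemma log2sqrt_eq x : 0 < x -> log2sqrt x = ln x / (2 * ln 2).
Proof.
  intros Hx. unfold log2sqrt.
  assert (Hl2 : 0 < ln 2) by (pose proof ln_lt_2; lra).
  assert (Hr : 0 < sqrt x) by (apply sqrt_lt_R0; exact Hx).
  rewrite <- (sqrt_sqrt x) at 2 by lra. rewrite ln_mult by exact Hr.
  field. lra.
Qed.

Lemma log2sqrt_le x y : 0 < x -> x <= y -> log2sqrt x <= log2sqrt y.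
Proof.
  intros Hx Hxy.
  assert (Hl2 : 0 < ln 2) by (pose proof ln_lt_2; lra).
  rewrite !log2sqrt_eq by lra.
  apply Rmult_le_compat_r; [left; apply Rinv_0_lt_compat; lra|].
  destruct Hxy as [Hlt | ->]; [left; apply ln_increasing|]; lra.
Qed.

Lemma log2sqrt_pow x k : 0 < x -> log2sqrt (x ^ k) = INR k * log2sqrt x.
Proof.
  intros Hx. rewrite !log2sqrt_eq by (try apply pow_lt; exact Hx).
  rewrite ln_pow by exact Hx. unfold Rdiv. ring.
Qed.

Lemma log2sqrt_2 : log2sqrt 2 = / 2.
Proof.
  assert (Hl2 : 0 < ln 2) by (pose proof ln_lt_2; lra).
  rewrite log2sqrt_eq by lra. field. lra.
Qed.

(* As (2 ^ S k) ^ 2 = 3 * pow4_sum k + 4, the second conjunct makes n the least level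
   with x <= pow4_sum n. *)
Lemma pow4_sum_level (x : R) (k : nat) : 0 < x -> x <= pow4_sum k ->
  exists n, x <= pow4_sum n /\ (2 ^ n) ^ 2 < 3 * x + 4.
Proof.
  intros Hx. induction k as [|k IH]; intros Hk.
  - unfold pow4_sum in Hk; simpl in Hk; lra.
  - destruct (Rle_or_lt x (pow4_sum k)) as [Hle | Hlt]; [exact (IH Hle)|].
    exists (S k). split; [exact Hk|]. rewrite <- pow4_sum_closed. lra.
Qed.

Lemma level_log2sqrt_bounds x n : 2 <= x -> x <= pow4_sum n -> (2 ^ n) ^ 2 < 3 * x + 4 ->
  / 2 * log2sqrt x <= INR n <= 4 * log2sqrt x.
Proof.
  intros Hx Hlo Hhi.
  assert (Hpos : 0 < 2 ^ n) by (apply pow_lt; lra).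
  assert (Hclosed := pow4_sum_closed n). rewrite <- (tech_pow_Rmult 2 n) in Hclosed.
  split.
  - assert (Hle : x <= (2 ^ n) ^ 4).
    { assert (Hsq := Rle_0_sqr ((2 ^ n) ^ 2 - 2 / 3)). unfold Rsqr in Hsq. nra. }
    apply log2sqrt_le in Hle; [|lra].
    rewrite !log2sqrt_pow, log2sqrt_2 in Hle by lra. simpl INR in Hle. lra.
  - assert (Hle : (2 ^ n) ^ 2 <= x ^ 4).
    { assert (Hx3 : 8 <= x ^ 3) by (replace 8 with (2 ^ 3) by ring; apply pow_incr; lra).
      replace (x ^ 4) with (x * x ^ 3) by ring. nra. }
    apply log2sqrt_le in Hle; [|apply pow_lt, Hpos].
    rewrite !log2sqrt_pow, log2sqrt_2 in Hle by lra. simpl INR in Hle. lra.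
Qed.

Lemma alpha_choice_level T Toff : (0 < T)%nat -> (0 < Toff)%nat ->
  exists lM,
    / 2 * log2sqrt (INR T + INR Toff) <= INR lM <= 4 * log2sqrt (INR T + INR Toff) /\
    INR T <= online_work lM (alpha_choice T Toff) /\
    offline_work lM (alpha_choice T Toff) <= 6 * INR Toff /\
    objective lM (alpha_choice T Toff) = INR T / INR Toff * pow2_sum lM /\
    pow2_sum lM <= 5 * sqrt (INR T + INR Toff).
Proof.
  intros HT HToff.
  assert (Ht : 1 <= INR T) by (apply (le_INR 1); exact HT).
  assert (Hto : 1 <= INR Toff) by (apply (le_INR 1); exact HToff).
  set (x := INR T + INR Toff).
  destruct (pow4_sum_level x (T + Toff)) as [lM [Hlo Hhi]].
  { unfold x; lra. }
  { unfold x; rewrite <- plus_INR; apply pow4_sum_ge_INR. }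
  exists lM.
  assert (Hp4 := pow4_sum_closed lM). rewrite <- (tech_pow_Rmult 2 lM) in Hp4.
  assert (Hp2 := pow2_sum_closed lM). rewrite <- (tech_pow_Rmult 2 lM) in Hp2.
  assert (Hpos : 0 < 2 ^ lM) by (apply pow_lt; lra).
  assert (Hcompl : 1 - INR Toff / x = INR T / x) by (unfold x; field; lra).
  unfold alpha_choice; fold x.
  rewrite online_work_const, offline_work_const, objective_const, Hcompl.
  split; [apply level_log2sqrt_bounds; unfold x in *; lra|].
  split.
  { replace (INR T) with (INR T / x * x) at 1 by (unfold x; field; lra).
    apply Rmult_le_compat_l; [left; apply Rdiv_lt_0_compat|]; unfold x in *; nra. }
  split.
  { replace (6 * INR Toff) with (INR Toff / x * (6 * x)) by (unfold x; field; lra).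
    apply Rmult_le_compat_l; [left; apply Rdiv_lt_0_compat|]; unfold x in *; nra. }
  split; [field; unfold x; lra|].
  assert (Hr : 0 <= sqrt x) by apply sqrt_pos.
  assert (Hrr : sqrt x * sqrt x = x) by (apply sqrt_sqrt; unfold x; lra).
  unfold x in *. nra.
Qed.

Lemma ratio_mul_le_div_sqrt (t u p : R) :
  0 < t < u -> p <= 5 * sqrt (t + u) -> t / u * p <= 10 * (t / sqrt (t + u)).
Proof.
  intros Htu Hp.
  set (r := sqrt (t + u)) in *.
  assert (Hr : 0 < r) by (apply sqrt_lt_R0; lra).
  assert (Hrr : r * r = t + u) by (apply sqrt_sqrt; lra).
  apply Rle_trans with (t / u * (5 * r)).
  { apply Rmult_le_compat_l; [left; apply Rdiv_lt_0_compat|]; lra. }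
  apply Rmult_le_reg_r with (u * r); [nra|].
  replace (t / u * (5 * r) * (u * r)) with (5 * t * (r * r)) by (field; lra).
  replace (10 * (t / r) * (u * r)) with (10 * t * u) by (field; lra).
  nra.
Qed.

Theorem proposition4p1 :
  (* (1) optimal value is Omega(T / sqrt(T + Toff)) *)
  (exists c : R, 0 < c /\
     forall (T Toff : nat), (1 <= T)%nat -> (1 <= Toff)%nat ->
     forall (lM : nat) (a : nat -> R), feasible T Toff lM a ->
       c * (INR T / sqrt (INR T + INR Toff)) <= objective lM a)
  /\
  (* (2) regime Toff > T: alpha_l = Toff/(T+Toff), l_M = Theta(log2 sqrt(T+Toff))
         is feasible (offline budget up to an absolute factor K, see NOTES)
         with objective O(T / sqrt(T + Toff)) *)
  (exists c1 c2 C K : R, 0 < c1 /\ 0 < c2 /\ 0 < C /\ 1 <= K /\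
     forall (T Toff : nat), (1 <= T)%nat -> (1 <= Toff)%nat -> (T < Toff)%nat ->
     exists lM : nat,
       c1 * log2sqrt (INR T + INR Toff) <= INR lM <= c2 * log2sqrt (INR T + INR Toff) /\
       INR T <= online_work lM (alpha_choice T Toff) /\
       offline_work lM (alpha_choice T Toff) <= K * INR Toff /\
       objective lM (alpha_choice T Toff) <= C * (INR T / sqrt (INR T + INR Toff)))
  /\
  (* (3) the same choice is optimal (up to an absolute constant) among
         schedules with alpha_l constant in l *)
  (exists c1 c2 C K : R, 0 < c1 /\ 0 < c2 /\ 0 < C /\ 1 <= K /\
     forall (T Toff : nat), (1 <= T)%nat -> (1 <= Toff)%nat ->
     exists lM : nat,
       c1 * log2sqrt (INR T + INR Toff) <= INR lM <= c2 * log2sqrt (INR T + INR Toff) /\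
       INR T <= online_work lM (alpha_choice T Toff) /\
       offline_work lM (alpha_choice T Toff) <= K * INR Toff /\
       forall (m : nat) (beta : R), feasible T Toff m (fun _ => beta) ->
         objective lM (alpha_choice T Toff) <= C * objective m (fun _ => beta)).
Proof.
  split; [|split].
  - exists 1. split; [lra|]. intros T Toff _ HToff lM a Hf.
    rewrite Rmult_1_l. exact (feasible_objective_ge_total _ _ _ _ HToff Hf).
  - exists (/ 2), 4, 10, 6. do 4 (split; [lra|]). intros T Toff HT HToff Hlt.
    destruct (alpha_choice_level T Toff HT HToff) as (lM & Hlog & Hon & Hoff & Hobj & Hp2).
    exists lM. do 3 (split; [assumption|]). rewrite Hobj.
    apply ratio_mul_le_div_sqrt; [split; [apply lt_0_INR | apply lt_INR]|]; assumption.
  - exists (/ 2), 4, 10, 6. do 4 (split; [lra|]). intros T Toff HT HToff.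
    destruct (alpha_choice_level T Toff HT HToff) as (lM & Hlog & Hon & Hoff & Hobj & Hp2).
    exists lM. do 3 (split; [assumption|]). intros m b Hf. rewrite Hobj.
    assert (Hconst := feasible_const_objective_ge _ _ _ _ HT HToff Hf).
    assert (Hsum := sqrt_add_le (INR T) (INR Toff) (pos_INR T) (pos_INR Toff)).
    assert (Hq : 0 <= INR T / INR Toff).
    { left; apply Rdiv_lt_0_compat; apply lt_0_INR; assumption. }
    apply Rle_trans with (INR T / INR Toff * (5 * (sqrt (INR T) + sqrt (INR Toff)))); [|lra].
    apply Rmult_le_compat_l; lra.
Qed.
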